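(* Consider the single-pilot full-guard OTFS pattern with pilot delay index $k_p$ satisfying $L-1\le k_p\le K-L$, and the GCE-BEM basis with oversampling factor $R\ge1$. For each delay tap $\ell\in\{0,\ldots,L-1\}$, the Gram matrix $\mathbf{T}_\ell\in\mathbb{C}^{Q\times Q}$ of the basis functions sampled on the pilot support, $\mathbf{T}_\ell[a,b]=\sum_{n\in\mathcal{P}_\ell}\phi_a^*[n]\phi_b[n]$, has entries $$\mathbf{T}_\ell[a,b]=\frac{1}{K}\exp\!\left(j\frac{2\pi(b-a)(k_p+\ell)}{NR}\right)\exp\!\left(j\frac{\pi(M-1)(b-a)}{MR}\right)\mathcal{D}_M\!\left(\frac{\pi(b-a)}{MR}\right),\quad a,b\in\{0,\ldots,Q-1\}.$$ Consequently $\mathbf{T}_\ell$ is Hermitian Toeplitz with diagonal entries $1/K$; for $R>1$, an off-diagonal entry $\mathbf{T}_\ell[a,b]$, $a\ne b$, vanishes only when $b-a$ is a nonzero integer multiple of $R$ and is not an integer multiple of $MR$; and $\mathrm{rank}(\mathbf{T}_\ell)\le M$, so that $\mathbf{T}_\ell$ can be invertible only if $Q\le M$. If $R=1$ and $Q\le M$, then $\mathbf{T}_\ell=\frac1K\mathbf{I}_Q$ for every $\ell$ and the pilot Gram matrix is $\mathbf{R}_{pp}=\frac{\mathcal{E}_p}{N}\mathbf{I}_{QL}$.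
   Context: Let $K,M,L,Q$ be positive integers and $N=KM$. GCE-BEM basis: $\phi_q[n]=\frac{1}{\sqrt N}\exp(j\omega_q n)$, $n=0,\ldots,N-1$, $q=0,\ldots,Q-1$, with $\omega_q=\frac{2\pi}{NR}\left(q-\lceil (Q-1)/2\rceil\right)$, $R\ge1$; $\boldsymbol{\Phi}\in\mathbb{C}^{N\times Q}$ is the matrix with columns $\phi_0,\ldots,\phi_{Q-1}$. $\mathcal{D}_M(x)=\sin(Mx)/(M\sin x)$ is the Dirichlet kernel, extended by continuity where $\sin x=0$ (so $\mathcal{D}_M(0)=1$). The OTFS pilot: a single pilot symbol $s_p\in\mathbb{C}$ at cell $(k_p,m_p)$ of a $K\times M$ delay--Doppler grid (delay index $k\in\{0,\ldots,K-1\}$, Doppler index $m\in\{0,\ldots,M-1\}$), with all other cells with delay index in $[k_p-L+1,k_p+L-1]$ set to zero (guard) and the remaining cells carrying payload. The pilot energy is $\mathcal{E}_p=|s_p|^2$. The time-domain pilot vector is $\mathbf{x}_p=(\mathbf{F}_M^H\otimes\mathbf{I}_K)\,\mathrm{vec}(\mathbf{S}_{\mathrm{pilot}})$, where $\mathbf{S}_{\mathrm{pilot}}\in\mathbb{C}^{K\times M}$ has the single nonzero entry $s_p$ at $(k_p,m_p)$, $\mathrm{vec}$ stacks columns, and $[\mathbf{F}_M]_{a,b}=M^{-1/2}e^{-j2\pi ab/M}$. The shifted pilot vectors are $\mathbf{z}_{p,\ell}[n]=\mathbf{x}_p[(n-\ell)\bmod N]$, $\ell=0,\ldots,L-1$,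 and the pilot support of tap $\ell$ is $\mathcal{P}_\ell=\{k_p+\ell+qK: q=0,\ldots,M-1\}$. The pilot Gram matrix is $\mathbf{R}_{pp}=\boldsymbol{\Psi}_p^H\boldsymbol{\Psi}_p$ with $\boldsymbol{\Psi}_p=[\mathrm{diag}(\mathbf{z}_{p,0})\boldsymbol{\Phi},\ldots,\mathrm{diag}(\mathbf{z}_{p,L-1})\boldsymbol{\Phi}]\in\mathbb{C}^{N\times QL}$. *)

(* Defs.v *)
From mathcomp Require Import all_boot all_order all_algebra.
From mathcomp Require Import complex.
From mathcomp Require mxtens.
From mathcomp Require Import all_classical all_reals all_analysis.

Set Implicit Arguments.
Unset Strict Implicit.
Unset Printing Implicit Defensive.

Import Order.TTheory GRing.Theory Num.Theory numFieldNormedType.Exports.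

Local Open Scope classical_set_scope.
Local Open Scope complex_scope.
Local Open Scope ring_scope.

(* Throughout, N = K M is written M * K, the dimension produced by the
   Kronecker product of an M x M and a K x K matrix; rho is the oversampling
   factor (R being the field of real numbers). *)

Section OTFS.
Variable R : realType.

(* e^{j x} *)
Definition expj (x : R) : R[i] := cos x +i* sin x.

Definition adjmx m n (A : 'M[R[i]]_(m, n)) : 'M[R[i]]_(n, m) :=
  map_mx Num.conj A^T.

(* At the zeros of sin, the value is the limit over the punctured
   neighbourhoods x^' (extension by continuity). *)
Definition dirichlet_kernel (M : nat) (x : R) : R :=
  let f (y : R) := sin (M%:R * y) / (M%:R * sin y) in
  if sin x == 0 then lim (f y @[y --> x^']) else f x.

(* uphalf n is the ceiling of n / 2. *)
Definition bem_freq (N Q : nat) (rho : R) (q : nat) : R :=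
  2 * pi / (N%:R * rho) * (q%:R - (uphalf Q.-1)%:R).

Definition bem_basis (N Q : nat) (rho : R) (q n : nat) : R[i] :=
  (Num.sqrt N%:R)^-1%:C * expj (bem_freq N Q rho q * n%:R).

Definition bem_mx (N Q : nat) (rho : R) : 'M[R[i]]_(N, Q) :=
  \matrix_(n < N, q < Q) bem_basis N Q rho q n.

Definition dft_mx (M : nat) : 'M[R[i]]_M :=
  \matrix_(a < M, b < M)
    ((Num.sqrt M%:R)^-1%:C * expj (- (2 * pi * a%:R * b%:R / M%:R))).

Definition pilot_grid (K M : nat) (kp : 'I_K) (mp : 'I_M) (sp : R[i]) :
  'M[R[i]]_(K, M) := sp *: delta_mx kp mp.

(* Column stacking: entry (k, m) goes to position m * K + k. *)
Definition vec_cols (K M : nat) (S : 'M[R[i]]_(K, M)) : 'cV[R[i]]_(M * K) :=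
  \col_(i < M * K)
    S (mxtens.mxtens_unindex i).2 (mxtens.mxtens_unindex i).1.

Definition pilot_vec (K M : nat) (kp : 'I_K) (mp : 'I_M) (sp : R[i]) :
  'cV[R[i]]_(M * K) :=
  mxtens.tensmx (adjmx (dft_mx M)) (1%:M : 'M[R[i]]_K)
    *m vec_cols (pilot_grid kp mp sp).

(* (n - l) mod N; reducing l first keeps the truncated subtraction exact. *)
Definition cyc_sub (N l : nat) (n : 'I_N) : 'I_N :=
  Ordinal (ltn_pmod (n + (N - l %% N))
             (leq_ltn_trans (leq0n n) (ltn_ord n))).

Definition shifted_pilot (K M : nat) (kp : 'I_K) (mp : 'I_M) (sp : R[i])
  (l : nat) : 'rV[R[i]]_(M * K) :=
  \row_(n < M * K) pilot_vec kp mp sp (cyc_sub l n) 0.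

(* Psi_p, the horizontal concatenation over the taps l < L; its width is
   \sum_(l < L) Q = Q L. *)
Definition pilot_regressor (K M L Q : nat) (rho : R) (kp : 'I_K) (mp : 'I_M)
  (sp : R[i]) : 'M[R[i]]_(M * K, \sum_(l < L) Q) :=
  \mxrow_(l < L)
    (diag_mx (shifted_pilot kp mp sp l) *m bem_mx (M * K) Q rho).

Definition pilot_gram (K M L Q : nat) (rho : R) (kp : 'I_K) (mp : 'I_M)
  (sp : R[i]) : 'M[R[i]]_(\sum_(l < L) Q) :=
  adjmx (pilot_regressor L Q rho kp mp sp)
    *m pilot_regressor L Q rho kp mp sp.

Definition pilot_support (K M : nat) (kp : 'I_K) (l : nat) :
  {set 'I_(M * K)} :=
  [set n : 'I_(M * K) | [exists q : 'I_M, n == (kp + l + q * K)%N :> nat]]%SET.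

Definition tap_gram (K M Q : nat) (rho : R) (kp : 'I_K) (l : nat) :
  'M[R[i]]_Q :=
  \matrix_(a < Q, b < Q)
    \sum_(n in pilot_support M kp l)
      Num.conj (bem_basis (M * K) Q rho a n) * bem_basis (M * K) Q rho b n.

Definition is_toeplitz (n : nat) (A : 'M[R[i]]_n) : Prop :=
  forall a b a' b' : 'I_n,
    (b%:Z - a%:Z = b'%:Z - a'%:Z)%R -> A a b = A a' b'.

Definition is_int_multiple (x y : R) : Prop := exists z : int, x = z%:~R * y.

Definition is_nonzero_int_multiple (x y : R) : Prop :=
  exists2 z : int, z != 0 & x = z%:~R * y.

End OTFS.

(* Main.v *)
From Pilot Require Import Defs.
From mathcomp Require Import all_boot all_order all_algebra.
From mathcomp Require Import complex.
From mathcomp Require Import all_classical all_reals all_analysis.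
From mathcomp Require Import ring zify.
From mathcomp Require mxtens.

(** Summing the pilot support in closed form gives a geometric sum of
    exponentials, [sum_(q < M) e^{2 j x q} = e^{j (M - 1) x} C_M(x)] with
    [C_M(x) = sum_(q < M) cos ((2 q + 1 - M) x)].  The function [C_M] is
    continuous and [C_M(x) sin x = sin (M x)], so the Dirichlet kernel is
    [C_M / M] everywhere, including at the zeros of [sin]; no case distinction
    is needed in the formula for the Gram matrix, and its zeros come from
    [sin (M x) = 0].  The rank bound holds because the tap Gram matrix is
    [P^H P] with [P] of size [M x Q].  The shifted pilots of distinct taps have
    disjoint supports (delay index [kp + l < K]) and constant modulus there, so
    the pilot Gram matrix is block diagonal with blocks proportional to the tap
    Gram matrices. *)

Set Implicit Arguments.
Unset Strict Implicit.
Unset Printing Implicit Defensive.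

Import Order.TTheory GRing.Theory Num.Theory numFieldNormedType.Exports.

Local Open Scope complex_scope.
Local Open Scope ring_scope.

(** * Complex exponentials, zeros of the sine and the Dirichlet kernel *)

Section Expj.
Variable R : realType.
Implicit Types x y : R.

Lemma expj0 : expj (0 : R) = 1.
Proof. by rewrite /expj sin0 cos0. Qed.

Lemma expjD x y : expj (x + y) = expj x * expj y.
Proof.
rewrite /expj sinD cosD; simpc; congr (_ +i* _).
by rewrite addrC.
Qed.

Lemma expj_conj x : Num.conj (expj x) = expj (- x).
Proof. by rewrite /expj sinN cosN. Qed.

Lemma expj_mulN x : expj x * expj (- x) = 1.
Proof. by rewrite -expjD subrr expj0. Qed.

Lemma expj_neq0 x : expj x != 0.
Proof.
by apply: contraTneq (oner_neq0 R[i]) => e; rewrite -(expj_mulN x) e mul0r eqxx.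
Qed.

Lemma expj_2pi_int (z : int) : expj (2 * pi * z%:~R : R) = 1.
Proof.
have e n : expj (2 * pi * n%:R : R) = 1.
  elim: n => [|n IH]; first by rewrite mulr0 expj0.
  rewrite -[n.+1%:R]natr1 mulrDr expjD IH mul1r mulr1 /expj mulr_natl.
  by rewrite sin2pi cos2pi.
case: z => n; first exact: e.
(* A negative exponent is multiplied by its positive counterpart, already known to be 1. *)
by rewrite NegzE mulrNz mulrN -[LHS]mul1r -{1}(e n.+1) expj_mulN.
Qed.

Lemma sinD_int_pi_eq0 x (z : int) : (sin (x + z%:~R * pi) == 0) = (sin x == 0).
Proof.
have e n y : (sin (y + n%:R * pi) == 0) = (sin y == 0).
  rewrite mulr_natl (alternatingn (@sinDpi R)) mulf_eq0.
  by rewrite signr_eq0.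
case: z => n; first exact: e.
by rewrite -[in RHS](subrK (n.+1%:R * pi) x) e NegzE mulrNz mulNr.
Qed.

(** Subtracting floor(x / pi) copies of pi leaves a remainder in [0, pi) whose sine is still zero;
    the sine is positive on (0, pi), so the remainder is 0. *)
Lemma sin_eq0 x : sin x = 0 -> exists z : int, x = z%:~R * pi.
Proof.
move=> sx0; exists (Num.floor (x / pi)).
have pi0 := @pi_gt0 R.
have /andP[le lt] := floor_itv (x / pi).
set z := Num.floor _ in le lt *.
have := sinD_int_pi_eq0 (x - z%:~R * pi) z.
rewrite subrK sx0 eqxx => /esym/eqP s0.
apply/eqP; rewrite -subr_eq0; apply/eqP.
move: le lt; rewrite ler_pdivlMr // ltr_pdivrMr // intrD mulrDl mul1r => le lt.
apply/eqP; rewrite eq_le subr_ge0 le andbT leNgt; apply/negP => gt.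
suff : 0 < sin (x - z%:~R * pi) by rewrite s0 ltxx.
by apply: sin_gt0_pi; rewrite gt ltrBlDl.
Qed.

Definition centered_cos_sum (M : nat) x : R :=
  \sum_(q < M) cos ((2 * q%:R + 1 - M%:R) * x).

(** The sum telescopes, since 2 cos u sin x = sin (u + x) - sin (u - x). *)
Lemma centered_cos_sum_sin M x : centered_cos_sum M x * sin x = sin (M%:R * x).
Proof.
(* The offset -M x is replaced by a free phase [t], so that it stays fixed in the induction on the
   number of terms. *)
suff H m t : (\sum_(q < m) cos ((2 * q%:R + 1) * x + t)) * (2 * sin x)
     = sin (2 * m%:R * x + t) - sin t.
  have := H M (- (M%:R * x)).
  rewrite (_ : \sum_(q < M) _ = centered_cos_sum M x); last first.
    by apply: eq_bigr => q _; congr cos; ring.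
  rewrite (_ : 2 * M%:R * x - M%:R * x = M%:R * x); last by ring.
  rewrite sinN => e; apply: (@mulfI _ 2) => //.
  by rewrite mulrCA e opprK mulr2n mulrDl mul1r.
elim: m => [|m IH]; first by rewrite big_ord0 mulr0 !mul0r add0r subrr.
rewrite big_ord_recr /= mulrDl IH -[m.+1%:R]natr1.
set u := (2 * m%:R + 1) * x + t.
have -> : 2 * m%:R * x + t = u - x by rewrite /u; ring.
have -> : 2 * (m%:R + 1) * x + t = u + x by rewrite /u; ring.
by rewrite (sinB u) (sinD u); ring.
Qed.

(* Reversing the order of summation conjugates the exponentials, so the
   imaginary parts cancel. *)
Lemma centered_expj_sum M x :
  \sum_(q < M) expj ((2 * q%:R + 1 - M%:R) * x) = (centered_cos_sum M x)%:C.
Proof.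
apply: (@mulfI _ 2) => //.
rewrite [LHS]mulr_natl mulr2n {2}(reindex_inj rev_ord_inj) /= -big_split /=.
rewrite /centered_cos_sum rmorph_sum mulr_sumr; apply: eq_bigr => q _.
have -> : (2 * (M - q.+1)%:R + 1 - M%:R) * x
  = - ((2 * q%:R + 1 - M%:R) * x) :> R.
  by rewrite natrB // -[q.+1%:R]natr1; ring.
rewrite /expj sinN cosN; simpc.
by congr (_ +i* _); ring.
Qed.

Lemma expj_geometric_sum M x :
  \sum_(q < M) expj (2 * x * q%:R) =
  expj ((M%:R - 1) * x) * (centered_cos_sum M x)%:C.
Proof.
rewrite -centered_expj_sum mulr_sumr; apply: eq_bigr => q _.
by rewrite -expjD; congr expj; ring.
Qed.

Lemma continuous_centered_cos_sum M : continuous (centered_cos_sum M).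
Proof.
move=> x; apply: cvg_big => [|q _]; first exact: add_continuous.
apply: continuous_comp; last exact: continuous_cos.
by apply: cvgM; [exact: cvg_cst | exact: cvg_id].
Qed.

(** Zeros of the sine are isolated: after translation to 0, a point with 0 < |h| < pi has nonzero
    sine. *)
Lemma near_sin_neq0 x : sin x = 0 -> \forall y \near (x^')%classic, sin y != 0.
Proof.
move=> /sin_eq0[z ->].
near=> y.
rewrite -(subrK (z%:~R * pi) y) sinD_int_pi_eq0.
set h := y - _.
have h0 : h != 0 by rewrite subr_eq0; near: y; exact: nbhs_dnbhs_neq.
have hpi : `|h| < pi.
  rewrite distrC; near: y.
  by apply: cvgr_dist_lt; [exact: nbhs_dnbhs | exact: pi_gt0].
move: h0 hpi; rewrite ltr_norml neq_lt => /orP[hl|hg] /andP[h1 h2].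
  by rewrite -[h]opprK sinN oppr_eq0 gt_eqF // sin_gt0_pi // oppr_gt0 hl ltrNl.
by rewrite gt_eqF // sin_gt0_pi // hg.
Unshelve. all: by end_near. Qed.

Lemma dirichlet_kernelE M x : (0 < M)%N ->
  dirichlet_kernel M x = M%:R^-1 * centered_cos_sum M x.
Proof.
move=> M0; have M0' : M%:R != 0 :> R by rewrite pnatr_eq0 -lt0n.
have fE y : sin y != 0 ->
  sin (M%:R * y) / (M%:R * sin y) = M%:R^-1 * centered_cos_sum M y.
  by move=> s0; rewrite -centered_cos_sum_sin; field; apply/andP.
rewrite /dirichlet_kernel; case: eqVneq => [s0|]; last exact: fE.
apply: cvg_lim => //.
have : (M%:R^-1 * centered_cos_sum M y @[y --> x^'] -->
        M%:R^-1 * centered_cos_sum M x)%classic.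
  apply/continuous_withinNx; apply: cvgM; first exact: cvg_cst.
  exact: continuous_centered_cos_sum.
(* The quotient agrees with this continuous function on a punctured neighbourhood, hence has the
   same limit. *)
apply: cvg_trans; apply: near_eq_cvg.
near=> y; apply/esym/fE; near: y; exact: near_sin_neq0.
Unshelve. all: by end_near. Qed.

End Expj.

(** * Entries, zeros and rank of the tap Gram matrices *)

Section TapGram.
Variable R : realType.

Lemma conj_real_complex (r : R) : Num.conj r%:C = r%:C.
Proof. exact: conjc_real. Qed.

Lemma inv_sqrt_natM n :
  (Num.sqrt (n%:R : R))^-1%:C * (Num.sqrt (n%:R : R))^-1%:C = n%:R^-1.
Proof.
by rewrite -rmorphM -invfM -expr2 sqr_sqrtr // fmorphV rmorph_nat.
Qed.

Lemma conj_bem_basisM N Q (rho : R) a b n :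
  Num.conj (bem_basis N Q rho a n) * bem_basis N Q rho b n =
  N%:R^-1 * expj (2 * pi * (b%:R - a%:R) * n%:R / (N%:R * rho)).
Proof.
rewrite /bem_basis rmorphM /= expj_conj conj_real_complex.
rewrite mulrACA inv_sqrt_natM -expjD; congr (_ * expj _).
by rewrite /bem_freq; ring.
Qed.

Variables (K M Q : nat) (rho : R) (kp : 'I_K).

(** The offset [kp + l] is below [K], so it is its own residue and the support is a full residue
    class modulo [K]. *)
Lemma in_pilot_support l (n : 'I_(M * K)) : (kp + l < K)%N ->
  (n \in pilot_support M kp l) = (n %% K == kp + l)%N.
Proof.
move=> lK; rewrite inE; apply/existsP/eqP => [[q /eqP->]|e].
  by rewrite addnC modnMDl modn_small.
exists (mxtens.mxtens_unindex n).1; rewrite /= -e addnC -divn_eq.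
exact: eqxx.
Qed.

Lemma sum_pilot_support (V : nmodType) (F : nat -> V) l : (kp + l < K)%N ->
  \sum_(n in pilot_support M kp l) F n = \sum_(q < M) F (kp + l + q * K)%N.
Proof.
move=> lK; pose h (q : 'I_M) := mxtens.mxtens_index (q, Ordinal lK).
have hE q : h q = (kp + l + q * K)%N :> nat by rewrite /h /= addnC.
have -> : pilot_support M kp l = [set h q | q : 'I_M]%SET.
  apply/setP => n; rewrite inE; apply/existsP/imsetP => [[q /eqP e]|[q _ ->]].
    by exists q => //; apply: ord_inj; rewrite hE.
  by exists q; rewrite hE.
rewrite big_imset => [|q q' _ _ /(congr1 (@mxtens.mxtens_unindex _ _))].
  by apply: eq_bigr => q _; rewrite hE.
by rewrite !mxtens.mxtens_indexK => -[].
Qed.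

Hypothesis rho_neq0 : rho != 0.
Hypothesis M_gt0 : (0 < M)%N.

Let K_gt0 : (0 < K)%N := leq_ltn_trans (leq0n kp) (ltn_ord kp).

(** Along n = kp + l + q K the offset contributes a common phase, and [K] cancels in the part linear
    in [q]. The sum is left unevaluated because the diagonal and the non-vanishing argument treat it
    term by term. *)
Lemma tap_gram_geometric l (a b : 'I_Q) : (kp + l < K)%N ->
  let x := pi * (b%:R - a%:R) / (M%:R * rho) in
  tap_gram M Q rho kp l a b =
  (M * K)%:R^-1
  * expj (2 * pi * (b%:R - a%:R) * (kp%:R + l%:R) / ((M * K)%:R * rho))
  * \sum_(q < M) expj (2 * x * q%:R).
Proof.
move=> lK x; rewrite mxE.
under eq_bigr do rewrite conj_bem_basisM.
rewrite (sum_pilot_support (fun n : nat => (M * K)%:R^-1 *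
  expj (2 * pi * (b%:R - a%:R) * n%:R / ((M * K)%:R * rho)))) //.
rewrite mulr_sumr; apply: eq_bigr => q _.
rewrite -[RHS]mulrA -expjD; congr (_ * expj _); rewrite /x !natrD !natrM.
have K0 : K%:R != 0 :> R by rewrite pnatr_eq0 -lt0n.
have M0 : M%:R != 0 :> R by rewrite pnatr_eq0 -lt0n.
by field; rewrite rho_neq0 K0 M0.
Qed.

Lemma tap_gram_dirichlet l (a b : 'I_Q) : (kp + l < K)%N ->
  let d : R := b%:R - a%:R in
  tap_gram M Q rho kp l a b =
    K%:R^-1
    * expj (2 * pi * d * (kp%:R + l%:R) / ((K * M)%:R * rho))
    * expj (pi * (M%:R - 1) * d / (M%:R * rho))
    * (dirichlet_kernel M (pi * d / (M%:R * rho)))%:C.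
Proof.
move=> lK d; rewrite tap_gram_geometric // expj_geometric_sum.
rewrite dirichlet_kernelE // (mulnC K M).
have -> (c : R) : (M%:R^-1 * c)%:C = M%:R^-1 * c%:C.
  by rewrite rmorphM fmorphV rmorph_nat.
rewrite natrM invfM -/d.
rewrite (_ : (M%:R - 1) * (pi * d / (M%:R * rho)) =
  pi * (M%:R - 1) * d / (M%:R * rho)); last by ring.
by ring.
Qed.

Lemma tap_gram_diag l (a : 'I_Q) : (kp + l < K)%N ->
  tap_gram M Q rho kp l a a = K%:R^-1.
Proof.
move=> lK; rewrite tap_gram_geometric // subrr !mulr0 !mul0r expj0 mulr1.
under eq_bigr do rewrite mulr0 mul0r expj0.
rewrite sumr_const card_ord natrM invfM mulrAC mulVf ?mul1r //.
by rewrite pnatr_eq0 -lt0n.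
Qed.

Lemma tap_gram_hermitian l : tap_gram M Q rho kp l \is hermsymmx.
Proof.
apply/is_hermitianmxP; rewrite expr0 scale1r; apply/matrixP => a b.
rewrite !mxE rmorph_sum; apply: eq_bigr => n _.
by rewrite rmorphM /= conjCK mulrC.
Qed.

Lemma tap_gram_toeplitz l : (kp + l < K)%N ->
  is_toeplitz (tap_gram M Q rho kp l).
Proof.
move=> lK a b a' b' e.
have {}e : b%:R - a%:R = b'%:R - a'%:R :> R.
  by have := congr1 (fun z : int => z%:~R : R) e; rewrite !intrB.
by rewrite !tap_gram_geometric // e.
Qed.

(** The other factors, phases and a positive constant, never vanish. *)
Lemma tap_gram_eq0 l (a b : 'I_Q) : (kp + l < K)%N ->
  (tap_gram M Q rho kp l a b == 0) =
  (centered_cos_sum M (pi * (b%:R - a%:R) / (M%:R * rho)) == 0).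
Proof.
move=> lK; rewrite tap_gram_geometric // expj_geometric_sum.
rewrite !mulf_eq0 invr_eq0 !(negPf (expj_neq0 _)) fmorph_eq0 orbF.
by rewrite pnatr_eq0 eqn0Ngt muln_gt0 M_gt0 K_gt0.
Qed.

Lemma tap_gram_vanish l (a b : 'I_Q) : (kp + l < K)%N -> a != b ->
  tap_gram M Q rho kp l a b = 0 ->
  is_nonzero_int_multiple (b%:R - a%:R) rho
  /\ ~ is_int_multiple (b%:R - a%:R) (M%:R * rho).
Proof.
move=> lK ab T0.
have M0 : M%:R != 0 :> R by rewrite pnatr_eq0 -lt0n.
have pi0 : pi != 0 :> R by rewrite gt_eqF ?pi_gt0.
split.
  have := centered_cos_sum_sin M (pi * (b%:R - a%:R) / (M%:R * rho)).
  move/eqP: T0; rewrite tap_gram_eq0 // => /eqP->; rewrite mul0r.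
  move=> /esym/sin_eq0[z e].
  have {}e : b%:R - a%:R = z%:~R * rho.
    apply: (mulfI pi0); apply: (mulIf (invr_neq0 rho_neq0)).
    rewrite (_ : pi * (z%:~R * rho) / rho = z%:~R * pi); last by field.
    by rewrite -e; field; rewrite M0 rho_neq0.
  exists z => //; apply: contraNneq ab => z0.
  move/eqP: e; rewrite z0 mul0r subr_eq0 eqr_nat => /eqP e.
  by apply/eqP/val_inj.
(* If b - a = z M rho, the phase of term [q] is 2 pi z q, so all [M] terms are 1 and the sum cannot
   vanish. *)
case=> z e; move/eqP: T0; apply/negP.
rewrite tap_gram_geometric // e.
under eq_bigr => q _.
  rewrite (_ : _ * q%:R = 2 * pi * (z * q%:Z)%:~R); last first.
    by rewrite intrM; field; rewrite M0 rho_neq0.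
  rewrite expj_2pi_int; over.
rewrite sumr_const card_ord !mulf_neq0 ?expj_neq0 //.
  by rewrite invr_eq0 pnatr_eq0 -lt0n muln_gt0 M_gt0.
by rewrite pnatr_eq0 -lt0n.
Qed.

Lemma tap_gram_rank l : (kp + l < K)%N ->
  (\rank (tap_gram M Q rho kp l) <= M)%N.
Proof.
move=> lK.
pose P : 'M[R[i]]_(M, Q) :=
  \matrix_(q, a) bem_basis (M * K) Q rho a (kp + l + q * K).
have -> : tap_gram M Q rho kp l = adjmx P *m P.
  apply/matrixP => a b; rewrite !mxE.
  rewrite (sum_pilot_support (fun n => Num.conj (bem_basis (M * K) Q rho a n)
    * bem_basis (M * K) Q rho b n)) //.
  by apply: eq_bigr => q _; rewrite !mxE.
exact: leq_trans (mxrankM_maxr _ _) (rank_leq_row _).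
Qed.

End TapGram.

(** * Tap Gram matrices without oversampling *)

Lemma tap_gram_critical (R : realType) (K M Q : nat) (kp : 'I_K) l :
  (0 < M)%N -> (Q <= M)%N -> (kp + l < K)%N ->
  tap_gram M Q (1 : R) kp l = (K%:R^-1)%:M.
Proof.
move=> M_gt0 QM lK; apply/matrixP => a b; rewrite [RHS]mxE.
have [->|ab] := eqVneq a b; first by rewrite tap_gram_diag ?oner_neq0.
apply/eqP; rewrite tap_gram_eq0 ?oner_neq0 // mulr1.
have M0 : M%:R != 0 :> R by rewrite pnatr_eq0 -lt0n.
set x := pi * _ / _.
have sMx : sin (M%:R * x) = 0.
  rewrite (_ : M%:R * x = 0 + (b%:Z - a%:Z)%:~R * pi).
    by apply/eqP; rewrite sinD_int_pi_eq0 sin0.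
  by rewrite /x intrB add0r; field.
have sx : sin x != 0.
  apply: contra ab => /eqP/sin_eq0[z].
  rewrite /x -mulrA mulrC => /(mulIf (lt0r_neq0 (@pi_gt0 R))) e.
  have {}e : (b%:Z - a%:Z)%:~R = (z * M%:Z)%:~R :> R.
    by rewrite intrB intrM -e mulfVK.
  move/eqP: e; rewrite eqr_int => /eqP e.
  (* The multiple z M is a difference of two indices below [Q <= M], so its absolute value is less
     than [M]. *)
  have z0 : z = 0.
    have := ltn_ord a; have := ltn_ord b; move: QM e; clear.
    move=> QM e bQ aQ.
    by nia.
  by move: e; rewrite z0 mul0r => /subr0_eq [] e; apply/eqP/val_inj.
by have /eqP := centered_cos_sum_sin M x; rewrite sMx mulf_eq0 (negPf sx) orbF.
Qed.

(** * Shifted pilots and the pilot Gram matrix *)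

Section PilotGram.
Variables (R : realType) (K M : nat) (kp : 'I_K) (mp : 'I_M) (sp : R[i]).

(** Only the column (mp, kp) of the Kronecker product meets the nonzero grid entry; its identity
    factor keeps delay [kp], and its DFT factor spreads the pilot over all [M] blocks of length
    [K]. *)
Lemma pilot_vecE (n : 'I_(M * K)) : pilot_vec kp mp sp n 0 =
  if (n %% K == kp)%N
  then Num.conj (dft_mx R M mp (mxtens.mxtens_unindex n).1) * sp else 0.
Proof.
have [[m k] ->] : exists mk, n = mxtens.mxtens_index mk.
  by exists (mxtens.mxtens_unindex n); rewrite mxtens.mxtens_unindexK.
rewrite mxtens.mxtens_indexK /= modnMDl modn_small ?ltn_ord //.
rewrite /pilot_vec mxE (bigD1 (mxtens.mxtens_index (mp, kp))) //=.
rewrite big1 => [|j jn].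
  rewrite mxtens.tensmxE !mxE !mxtens.mxtens_indexK !eqxx addr0 mulr1.
  have [->|kk] := eqVneq k kp; first by rewrite eqxx mulr1.
  by rewrite (negPf kk : (k == kp :> nat) = false) mulr0 mul0r.
rewrite [vec_cols _ _ _]mxE !mxE.
case: andP => [[/eqP e1 /eqP e2]|]; last first.
  by rewrite !mulr0.
case/eqP: jn; rewrite -[j]mxtens.mxtens_unindexK; congr mxtens.mxtens_index.
by case: (mxtens.mxtens_unindex j) e1 e2 => ? ? /= -> ->.
Qed.

Lemma dft_mx_conjM (a b : 'I_M) :
  dft_mx R M a b * Num.conj (dft_mx R M a b) = M%:R^-1.
Proof.
rewrite mxE rmorphM /= expj_conj conj_real_complex.
by rewrite mulrACA expj_mulN inv_sqrt_natM mulr1.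
Qed.

(** Since [K] divides [M * K], the cyclic reduction preserves residues modulo [K]; adding [l] to
    both sides undoes the shift. *)
Lemma cyc_sub_mod l (n : 'I_(M * K)) : (kp + l < K)%N ->
  (cyc_sub l n %% K == kp)%N = (n %% K == kp + l)%N.
Proof.
move=> lK; have lN : (l < M * K)%N.
  apply: leq_ltn_trans (leq_addl kp l) (leq_trans lK _).
  by rewrite leq_pmull // (leq_ltn_trans (leq0n _) (ltn_ord mp)).
rewrite /= modn_dvdm ?dvdn_mull // (modn_small lN).
rewrite -[X in _ == X](modn_small (ltn_ord kp)) -(eqn_modDr l).
by rewrite -addnA subnK ?(ltnW lN) // addnC modnMDl (modn_small lK).
Qed.

Lemma shifted_pilotE l (n : 'I_(M * K)) : (kp + l < K)%N ->
  shifted_pilot kp mp sp l 0 n =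
  if n \in pilot_support M kp l
  then Num.conj (dft_mx R M mp (mxtens.mxtens_unindex (cyc_sub l n)).1) * sp
  else 0.
Proof.
by move=> lK; rewrite mxE pilot_vecE cyc_sub_mod // in_pilot_support.
Qed.

(** Distinct taps occupy distinct residues modulo [K]; for equal taps the DFT phase cancels against
    its conjugate. *)
Lemma shifted_pilot_conjM l l' (n : 'I_(M * K)) :
  (kp + l < K)%N -> (kp + l' < K)%N ->
  Num.conj (shifted_pilot kp mp sp l 0 n) * shifted_pilot kp mp sp l' 0 n =
  if (l == l') && (n \in pilot_support M kp l) then `|sp| ^+ 2 / M%:R else 0.
Proof.
move=> lK lK'; rewrite !shifted_pilotE // !in_pilot_support //.
have [e|_] := eqVneq (n %% K)%N (kp + l)%N; last first.
  by rewrite rmorph0 mul0r andbF.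
rewrite andbT e eqn_add2l; have [<-|_] := eqVneq l l'; last by rewrite mulr0.
rewrite rmorphM /= conjCK mulrACA dft_mx_conjM normCK mulrC.
by congr (_ * _); rewrite mulrC.
Qed.

(** A flat column index decodes into its tap, [tagnat.sig1 i], and its basis index,
    [tagnat.sig2 i]. *)
Lemma pilot_regressorE L Q (rho : R) (n : 'I_(M * K))
    (i : 'I_(\sum_(l < L) Q)) :
  pilot_regressor L Q rho kp mp sp n i =
  shifted_pilot kp mp sp (tagnat.sig1 i) 0 n
  * bem_basis (M * K) Q rho (tagnat.sig2 i) n.
Proof. by rewrite [LHS]mxE mul_diag_mx [LHS]mxE [bem_mx _ _ _ _ _]mxE. Qed.

Lemma pilot_gramE L Q (rho : R) (i j : 'I_(\sum_(l < L) Q)) : (kp + L <= K)%N ->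
  pilot_gram L Q rho kp mp sp i j =
  if tagnat.sig1 i == tagnat.sig1 j
  then `|sp| ^+ 2 / M%:R
    * tap_gram M Q rho kp (tagnat.sig1 i) (tagnat.sig2 i) (tagnat.sig2 j)
  else 0.
Proof.
move=> kpL.
have lK (l : 'I_L) : (kp + l < K)%N.
  by apply: leq_trans kpL; rewrite ltn_add2l.
rewrite mxE.
under eq_bigr => n _.
  rewrite [adjmx _ _ _]mxE [_^T _ _]mxE !pilot_regressorE rmorphM /= mulrACA.
  rewrite shifted_pilot_conjM // -[_ == _ :> nat]/(_ == _ :> 'I_L); over.
case: eqVneq => [_|_]; last by rewrite big1 // => n _; rewrite mul0r.
rewrite [tap_gram _ _ _ _ _ _ _]mxE mulr_sumr [RHS]big_mkcond /=.
by apply: eq_bigr => n _; case: ifP => // _; rewrite mul0r.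
Qed.

Lemma pilot_gram_critical L Q : (kp + L <= K)%N -> (Q <= M)%N ->
  pilot_gram L Q 1 kp mp sp = (`|sp| ^+ 2 / (K * M)%:R)%:M.
Proof.
move=> kpL QM; apply/matrixP => i j; rewrite pilot_gramE // [RHS]mxE.
have lK (l : 'I_L) : (kp + l < K)%N.
  by apply: leq_trans kpL; rewrite ltn_add2l.
rewrite tap_gram_critical ?(leq_ltn_trans (leq0n _) (ltn_ord mp)) // mxE.
(* The flat index is determined by its tap and basis index, so scalar blocks assemble into one
   scalar matrix. *)
have -> : (i == j) = (tagnat.sig1 i == tagnat.sig1 j)
    && (tagnat.sig2 i == tagnat.sig2 j :> nat).
  by rewrite -tagnat.eq_Rank !tagnat.sig2K.
case: (tagnat.sig1 i == _) => //=; rewrite mulrnAr natrM invfM.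
by congr (_ *+ _); ring.
Qed.

End PilotGram.

Unset Implicit Arguments.

Theorem mainTheorem7 (R : realType) (K M L Q : nat) (rho : R)
  (kp : 'I_K) (mp : 'I_M) (sp : R[i])
  (K_gt0 : (0 < K)%N) (M_gt0 : (0 < M)%N)
  (L_gt0 : (0 < L)%N) (Q_gt0 : (0 < Q)%N)
  (rho_ge1 : 1 <= rho)
  (kp_ge : (L - 1 <= kp)%N) (kp_le : (kp + L <= K)%N) :
  (forall l : 'I_L,
    let T := tap_gram M Q rho kp l in
    [/\ (forall a b : 'I_Q,
          let d : R := b%:R - a%:R in
          T a b =
            K%:R^-1
            * expj (2 * pi * d * (kp%:R + l%:R) / ((K * M)%:R * rho))
            * expj (pi * (M%:R - 1) * d / (M%:R * rho))
            * (dirichlet_kernel M (pi * d / (M%:R * rho)))%:C),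
        [/\ T \is hermsymmx, is_toeplitz T & forall a : 'I_Q, T a a = K%:R^-1],
        (1 < rho -> forall a b : 'I_Q, a != b -> T a b = 0 ->
          is_nonzero_int_multiple (b%:R - a%:R) rho
          /\ ~ is_int_multiple (b%:R - a%:R) (M%:R * rho)),
        (\rank T <= M)%N
      & (T \in unitmx -> (Q <= M)%N)])
  /\
  (rho = 1 -> (Q <= M)%N ->
    (forall l : 'I_L, tap_gram M Q rho kp l = (K%:R^-1)%:M)
    /\ pilot_gram L Q rho kp mp sp = (`|sp| ^+ 2 / (K * M)%:R)%:M).
Proof.
have lK (l : 'I_L) : (kp + l < K)%N.
  by apply: leq_trans kp_le; rewrite ltn_add2l.
split=> [l T|rho1 QM].
  have rho0 : rho != 0 by rewrite gt_eqF // (lt_le_trans ltr01).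
  have rankT : (\rank T <= M)%N by apply: tap_gram_rank.
  split=> //.
  - by move=> a b d; apply: tap_gram_dirichlet.
  - split; [exact: tap_gram_hermitian | exact: tap_gram_toeplitz |].
    by move=> a; apply: tap_gram_diag.
  - by move=> _ a b; apply: tap_gram_vanish.
  (* Invertibility means full row rank, which turns [Q] into [\rank T]. *)
  - by rewrite -row_free_unit => /eqP <-.
rewrite rho1; split=> [l|]; first exact: tap_gram_critical.
exact: pilot_gram_critical.
Qed.
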